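(* Let $X_1,\dots,X_n$ be smooth manifolds with Borel probability measures $\mu_1,\dots,\mu_n$, and let $c:X_1\times\cdots\times X_n\to\mathbb{R}$ be a cost function satisfying the standing assumptions. Assume that $c$ satisfies the generalized-twist condition on $c$-splitting sets and that $\mu_1$ is non-atomic. Then for each optimal plan $\gamma$ of $(MK)$ with $\mathrm{Supp}(\gamma)\subset D_1(c)$ there exist $k\in\mathbb{N}\cup\{\infty\}$, a (finite or infinite) sequence of non-negative measurable real functions $\{\alpha_i\}_{i=1}^k$ on $X_1$, and Borel measurable maps $\{G_i\}_{i=1}^k$, $G_i:X_1\to X_2\times\cdots\times X_n$, such that $$\gamma=\sum_{i=1}^k\alpha_i\,(\mathrm{Id}\times G_i)_\#\mu_1,$$ where $\sum_{i=1}^k\alpha_i(x)=1$ for $\mu_1$-a.e. $x\in X_1$.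
   Context: Setting. $\Pi(\mu_1,\dots,\mu_n)$ is the set of Borel probability measures on $X_1\times\cdots\times X_n$ whose $X_i$-marginal is $\mu_i$ for each $i$. For $\pi\in\Pi(\mu_1,\dots,\mu_n)$, $I_c(\pi)=\int c\,d\pi$. The Monge–Kantorovich problem $(MK)$ is $\inf\{I_c(\pi):\pi\in\Pi(\mu_1,\dots,\mu_n)\}$, and a minimizer is called an optimal plan. $\mathrm{Supp}(\gamma)$ is the support of $\gamma$. Standing assumptions on $c$. $c: X_1\times\cdots\times X_n\to\mathbb{R}$ is non-negative, lower semi-continuous, differentiable with respect to the first variable at $\mu_1\otimes\cdots\otimes\mu_n$-almost every point, and $I_c(\pi)$ is finite for some $\pi\in\Pi(\mu_1,\dots,\mu_n)$. Moreover, the Kantorovich dual problem admits a solution: there are Borel functions $\varphi_i:X_i\to\mathbb{R}$, $\varphi_i\in L^1(\mu_i)$, such that $\varphi_1$ is differentiable $\mu_1$-a.e., $\varphi_1(x_1)+\cdots+\varphi_n(x_n)\le c(x_1,\dots,x_n)$ for all $(x_1,\dots,x_n)$, and $\int c\,d\gamma=\sum_{i=1}^n\int_{X_i}\varphi_i\,d\mu_i$ for optimal plans $\gamma$. $D_1(c)$ is the set of points of $X_1\times\cdots\times X_n$ at which $c$ is differentiable with respect to the first variable, and $D_{x_1}c$ denotes that derivative. $c$-splitting set. A set $S\subset X_1\times\cdots\times X_n$ is a $c$-splitting set if there exist Borel functions $u_i:X_i\to\mathbb{R}$ such that $\sum_{i=1}^n u_i(x_i)\le c(x_1,\dots,x_n)$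 for all $(x_1,\dots,x_n)$, with equality whenever $(x_1,\dots,x_n)\in S$. Generalized-twist condition. $c$ satisfies the generalized-twist condition on $c$-splitting sets if for any $c$-splitting set $S$ and any $(\bar x_1,\dots,\bar x_n)\in S\cap D_1(c)$ the set $$\Big\{(\bar x_1,x_2,\dots,x_n)\in S\cap D_1(c):\ D_{x_1}c(\bar x_1,\bar x_2,\dots,\bar x_n)=D_{x_1}c(\bar x_1,x_2,\dots,x_n)\Big\}$$ is a finite subset of $S$. Notation. $\mathrm{Id}\times G_i$ is the map $x\mapsto(x,G_i(x))$, and $\#$ denotes push-forward. The formula $\gamma=\sum_i\alpha_i(\mathrm{Id}\times G_i)_\#\mu_1$ means $\int f\,d\gamma=\sum_i\int_{X_1}\alpha_i(x)f(x,G_i(x))\,d\mu_1(x)$ for every bounded continuous $f:X_1\times\cdots\times X_n\to\mathbb{R}$. When $k=\infty$ the sums range over all $i\in\mathbb{N}$, $i\ge1$. *)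

(* Defs.v *)
From HB Require Import structures.
From mathcomp Require Import all_boot all_order all_algebra.
From mathcomp Require Import all_classical all_reals all_analysis.

Set Implicit Arguments.
Unset Strict Implicit.
Unset Printing Implicit Defensive.

Import Order.TTheory GRing.Theory Num.Theory.
Import numFieldNormedType.Exports.

Local Open Scope classical_set_scope.
Local Open Scope ring_scope.

(** * Smooth manifolds *)

(* [f] is of class C^k on the open set [U]: C^(k+1) means differentiable with
   all directional derivatives of class C^k. *)
Fixpoint classC (R : realType) (V W : normedModType R) (k : nat)
    (U : set V) (f : V -> W) : Prop :=
  match k with
  | 0 => forall x, U x -> {for x, continuous f}
  | k'.+1 => (forall x, U x -> differentiable f x) /\
             (forall v, classC k' U (fun x => 'D_v f x))
  end.

Definition smooth_on (R : realType) (V W : normedModType R)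
    (U : set V) (f : V -> W) : Prop := forall k, classC k U f.

(* [chart_map] and [chart_inv] are total functions; only their values on
   [chart_dom] and on its image are meaningful. *)
Record chart (R : realType) (d : nat) (X : topologicalType) := Chart {
  chart_dom : set X ;
  chart_map : X -> 'rV[R]_d ;
  chart_inv : 'rV[R]_d -> X ;
  chart_dom_open : open chart_dom ;
  chart_im_open : open (chart_map @` chart_dom) ;
  chart_mapK : forall x, chart_dom x -> chart_inv (chart_map x) = x ;
  chart_map_cont : forall x, chart_dom x -> {for x, continuous chart_map} ;
  chart_inv_cont : forall y, (chart_map @` chart_dom) y ->
    {for y, continuous chart_inv} }.

(* The atlas is not required to be maximal: passing to the maximal atlas changes
   neither differentiability nor equality of derivatives.  The base point of
   [ptopologicalType] is only there because the measurable spaces of the library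
   are pointed; a manifold carrying a probability measure is nonempty. *)
Record smoothManifold (R : realType) := SmoothManifold {
  mcarrier :> ptopologicalType ;
  mdim : nat ;
  atlas : set (chart R mdim mcarrier) ;
  manifold_hausdorff : hausdorff_space mcarrier ;
  manifold_second_countable : @second_countable mcarrier ;
  atlas_cover : forall x, exists2 e, atlas e & chart_dom e x ;
  atlas_compat : forall e1 e2, atlas e1 -> atlas e2 ->
    smooth_on (chart_map e1 @` (chart_dom e1 `&` chart_dom e2))
      (chart_map e2 \o chart_inv e1) }.

Section manifold_derivative.
Variables (R : realType) (M : smoothManifold R).
Implicit Types (f : M -> R) (x : M).

Definition charts_at x : set (chart R (mdim M) M) :=
  [set e | atlas e /\ chart_dom e x].

Definition mdifferentiable f x : Prop :=
  forall e, charts_at x e ->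
    differentiable (f \o chart_inv e : _ -> R^o) (chart_map e x).

(* The derivative of [f] at [x] is a covector at [x], represented by the family
   of its coordinate expressions in all the charts around [x]. *)
Definition mderiv f x (e : chart R (mdim M) M) (v : 'rV[R]_(mdim M)) : R :=
  if `[< charts_at x e >]
  then 'd (f \o chart_inv e : _ -> R^o) (chart_map e x) v else 0.

End manifold_derivative.

(** * Borel measures *)

Definition borel (T : ptopologicalType) : measurableType (@open T).-sigma :=
  g_sigma_algebraType (@open T).

Definition msupport (R : realType) (T : ptopologicalType)
    (mu : probability (borel T) R) : set T :=
  [set x | forall U : set T, open U -> U x -> (0 < mu U)%E].

Definition non_atomic (R : realType) d (T : measurableType d)
    (mu : probability T R) : Prop :=
  forall A, measurable A -> (0 < mu A)%E ->
    exists B, [/\ measurable B, B `<=` A, (0 < mu B)%E & (mu B < mu A)%E].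

(** * Products *)

HB.instance Definition _ (I : Type) (T : I -> ptopologicalType) :=
  Pointed.copy (prod_topology T) (forall i, T i).

(* X_1 x ... x X_n, indexed from 0, with the product topology *)
Definition mprod (R : realType) (n : nat) (X : 'I_n -> smoothManifold R) :
  ptopologicalType := prod_topology (fun i => mcarrier (X i)).

(* X_2 x ... x X_n *)
Definition mtail (R : realType) (n : nat) (X : 'I_n.+1 -> smoothManifold R) :
  ptopologicalType := mprod (fun j => X (lift ord0 j)).

(* the point (x, y) of X_1 x (X_2 x ... x X_n) *)
Definition mcons (n : nat) (T : 'I_n.+1 -> Type) (x : T ord0)
    (y : forall j : 'I_n, T (lift ord0 j)) (i : 'I_n.+1) : T i :=
  match unliftP ord0 i with
  | UnliftSome j e => ecast k (T k) (esym e) (y j)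
  | UnliftNone e => ecast k (T k) (esym e) x
  end.

Lemma mcons0 n (T : 'I_n.+1 -> Type) x y : @mcons n T x y ord0 = x.
Proof.
rewrite /mcons; case: unliftP => [j e|e].
  by have := congr1 val e.
by rewrite (eq_irrelevance e erefl).
Qed.

Lemma mcons_lift n (T : 'I_n.+1 -> Type) x y j :
  @mcons n T x y (lift ord0 j) = y j.
Proof.
rewrite /mcons; case: unliftP => [k e|e]; last by have := congr1 val e.
have jk := lift_inj e; subst k.
by rewrite (eq_irrelevance e erefl).
Qed.

Section multimarginal.
Variables (R : realType) (n : nat) (X : 'I_n.+2 -> smoothManifold R).
Variable mu : forall i, probability (borel (X i)) R.
Variable c : mprod X -> R.

Definition is_product_measure (P : probability (borel (mprod X)) R) : Prop :=
  forall A : forall i, set (borel (X i)), (forall i, measurable (A i)) ->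
    P [set x | forall i, A i (x i)] = (\prod_(i < n.+2) mu i (A i))%E.

(** ** The Monge-Kantorovich problem *)

Definition plan (pi : probability (borel (mprod X)) R) : Prop :=
  forall i (A : set (borel (X i))), measurable A ->
    pushforward pi (fun x : borel (mprod X) => x i : borel (X i)) A = mu i A.

Definition total_cost (pi : probability (borel (mprod X)) R) : \bar R :=
  (\int[pi]_x (c x)%:E)%E.

Definition optimal_plan (gamma : probability (borel (mprod X)) R) : Prop :=
  plan gamma /\ forall pi, plan pi -> (total_cost gamma <= total_cost pi)%E.

(** ** Differentiability in the first variable *)

Definition first_slice (x : mprod X) (y : X ord0) : R :=
  c (dfwith x ord0 y).

Definition D1 : set (mprod X) :=
  [set x | mdifferentiable (first_slice x) (x ord0)].

Definition Dx1 (x : mprod X) := mderiv (first_slice x) (x ord0).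

(** ** Assumptions on the cost *)

Definition dual_attained : Prop :=
  exists phi : forall i, X i -> R,
  [/\ forall i, measurable_fun setT (phi i : borel (X i) -> R),
      forall i, (mu i).-integrable setT (EFin \o phi i),
      {ae mu ord0, forall x, mdifferentiable (phi ord0) x},
      forall x : mprod X, \sum_i phi i (x i) <= c x &
      forall gamma, optimal_plan gamma ->
        (\int[gamma]_x (c x)%:E = \sum_i \int[mu i]_x (phi i x)%:E)%E].

(* In the third clause, [P] is the product measure of the [mu i], which exists
   and is unique since the [X i] are second countable. *)
Record standing_assumptions : Prop := StandingAssumptions {
  cost_ge0 : forall x, 0 <= c x ;
  cost_lsc : lower_semicontinuous (EFin \o c) ;
  cost_ae_diff : exists2 P : probability (borel (mprod X)) R,
    is_product_measure P & {ae P, forall x, D1 x} ;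
  cost_finite : exists2 pi, plan pi & total_cost pi \is a fin_num ;
  cost_dual : dual_attained }.

Definition c_splitting (S : set (mprod X)) : Prop :=
  exists u : forall i, X i -> R,
  [/\ forall i, measurable_fun setT (u i : borel (X i) -> R),
      forall x : mprod X, \sum_i u i (x i) <= c x &
      forall x, S x -> \sum_i u i (x i) = c x].

Definition generalized_twist : Prop :=
  forall S, c_splitting S -> forall xb, (S `&` D1) xb ->
    finite_set [set x | [/\ (S `&` D1) x, x ord0 = xb ord0 & Dx1 xb = Dx1 x]].

End multimarginal.

(** * Sums of measures concentrated on graphs *)

(* [k = Some m] encodes a finite number m of terms, [k = None] encodes
   k = infinity; terms are indexed from 0. *)
Definition index_lt (k : option nat) (i : nat) : Prop :=
  if k is Some m then (i < m)%N else True.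

Definition has_sum (R : realType) (k : option nat) (a : nat -> \bar R)
    (l : \bar R) : Prop :=
  if k is Some m then (\sum_(i < m) a i)%E = l
  else (fun N => \sum_(i < N) a i)%E @ \oo --> l.

(* gamma = sum_i alpha_i (Id x G_i)_# mu *)
Definition is_sum_of_graphs (R : realType) (n : nat)
    (X : 'I_n.+2 -> smoothManifold R)
    (gamma : probability (borel (mprod X)) R)
    (mu : probability (borel (X ord0)) R) (k : option nat)
    (alpha : nat -> X ord0 -> R) (G : nat -> X ord0 -> mtail X) : Prop :=
  forall f : mprod X -> R, continuous f -> (exists B, forall x, `|f x| <= B) ->
    has_sum k (fun i => \int[mu]_x (alpha i x * f (mcons x (G i x)))%:E)%E
      (\int[gamma]_x (f x)%:E)%E.

(* Main.v *)
Require Import Defs.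
From HB Require Import structures.
From mathcomp Require Import all_boot all_order all_algebra.
From mathcomp Require Import all_classical all_reals all_analysis.
From mathcomp Require Import measurable_realfun.

Set Implicit Arguments.
Unset Strict Implicit.
Unset Printing Implicit Defensive.

Import Order.TTheory GRing.Theory Num.Theory.
Import numFieldNormedType.Exports.

Local Open Scope classical_set_scope.
Local Open Scope ring_scope.

(** Let phi be a dual solution and S the set where the sum of the phi_i equals
    c, which is a c-splitting set.  The integrals of c and of the sum of the
    phi_i against an optimal plan gamma are equal and finite, so gamma is
    carried by S ([contact_full]); it is also carried by its support, hence by
    D_1(c), and by the points whose first coordinate is a point of
    differentiability of phi_1.  On the resulting Borel set Gamma of full
    measure, the function c - sum phi_i of the first variable is minimal, so
    D_(x_1) c = d phi_1 depends on x_1 only ([Dx1_contact]), and the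
    generalized twist condition says that the fibres of Gamma over X_1 are
    finite.

    What remains is to cut a measure carried by a set with finite fibres into
    graphs.  Inner regularity ([measurable_inner]) replaces Gamma by a
    sigma-compact subset K of full measure.  The point of passing to K is that
    continuous images of its relatively open subsets are again sigma-compact,
    hence Borel, so that no selection theorem is needed.  For an open set w_j of
    a countable base, the set E_j of the x_1 over which K meets w_j in exactly
    one point is Borel, this point depends on x_1 in a Borel way, and since the
    points of a finite fibre are isolated the graphs so obtained cover K
    ([measurable_sections_cover]).  After making the graphs disjoint,
    the i-th piece of gamma projects to a measure on X_1 dominated by mu_1, and
    alpha_i is its Radon-Nikodym density ([graph_densities]).  The
    decomposition is always written as an infinite one. *)

(** * Countable bases and sigma-compact sets *)

(** [b] enumerates a base of open sets of [T]; some [b n] may be empty. *)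
Definition base_seq (T : topologicalType) (b : nat -> set T) : Prop :=
  (forall n, open (b n)) /\
  forall x U, nbhs x U -> exists2 n, b n x & b n `<=` U.

Lemma second_countable_base_seq (T : topologicalType) :
  @second_countable T -> exists b : nat -> set T, base_seq b.
Proof.
move=> [B /countable_injP[f finj] [Bo Bn]].
exists (fun n x => exists2 U, B U /\ f U = n & U x); split.
- move=> n; rewrite openE => x [U [BU fU] Ux].
  have := open_nbhs_nbhs (conj (Bo _ BU) Ux).
  by apply: filterS => y Uy; exists U.
- move=> x U /Bn [V [BV Vx] VU]; exists (f V); first by exists V.
  move=> y [W [BW fWV] Wy]; apply: VU.
  by rewrite -(finj W V) ?inE.
Qed.

(** Local compactness in its strong form: compact neighborhoods form a
    neighborhood base at every point. *)
Definition compact_nbhs_base (T : topologicalType) : Prop :=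
  forall (x : T) U, nbhs x U -> exists K, [/\ nbhs x K, compact K & K `<=` U].

(** [A] is a countable union of compact sets. *)
Definition sigma_compact (T : topologicalType) (A : set T) : Prop :=
  exists2 F : nat -> set T, forall n, compact (F n) & A = \bigcup_n F n.

(** The basic open sets contained in some compact subset of [U] cover [U]. *)
Lemma open_sigma_compact (T : topologicalType) (b : nat -> set T) (U : set T) :
  base_seq b -> compact_nbhs_base T -> open U -> sigma_compact U.
Proof.
move=> [_ bn] lc oU.
(* a compact subset of U that contains b n, when there is one *)
have ex n : exists K, [/\ compact K, K `<=` U &
    forall L, compact L -> b n `<=` L -> L `<=` U -> b n `<=` K].
  have [[L [cL bL LU]]|noL] :=
      pselect (exists L, [/\ compact L, b n `<=` L & L `<=` U]).
    by exists L; split.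
  exists set0; split; [exact: compact0 | exact: sub0set |].
  by move=> L cL bL LU; case: noL; exists L.
have [F FP] := boolp.choice ex; exists F; first by move=> n; case: (FP n).
apply/seteqP; split => [x Ux|x [n _]]; last by case: (FP n) => _ + _; exact.
have [K [xK cK KU]] := lc x U (open_nbhs_nbhs (conj oU Ux)).
have [n bx bK] := bn x K xK.
by exists n => //; case: (FP n) => _ _ /(_ K cK bK KU); apply.
Qed.

Lemma sigma_compact_image (S T : topologicalType) (f : S -> T) (A : set S) :
  continuous f -> sigma_compact A -> sigma_compact (f @` A).
Proof.
move=> cf [F cF ->]; exists (fun n => f @` F n); last by rewrite image_bigcup.
by move=> n; apply: continuous_compact => //; exact: continuous_subspaceT.
Qed.

Lemma bigcup_sigma_compact (T : topologicalType) (A : nat -> set T) :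
  (forall n, sigma_compact (A n)) -> sigma_compact (\bigcup_n A n).
Proof.
move=> sA.
have [F FP] := boolp.choice (fun n => (let: ex_intro2 F p q := sA n in
  ex_intro (fun F => (forall m, compact (F m)) /\ A n = \bigcup_m F m) F
    (conj p q))).
exists (fun k => if unpickle k is Some nm then F nm.1 nm.2 else set0).
  move=> k; case: (unpickle k) => [nm|]; last exact: compact0.
  by case: (FP nm.1).
apply/seteqP; split=> [x [n _]|x [k _]].
  rewrite (FP n).2 => -[m _ Fx]; exists (pickle (n, m)) => //.
  by rewrite pickleK.
case: unpickle => [nm Fx|//]; exists nm.1 => //.
by rewrite (FP nm.1).2; exists nm.2.
Qed.

Lemma sigma_compactI (T : topologicalType) (A B : set T) :
  hausdorff_space T -> sigma_compact A -> sigma_compact B ->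
  sigma_compact (A `&` B).
Proof.
move=> hT [F cF ->] [G cG ->].
have -> : \bigcup_n F n `&` \bigcup_n G n = \bigcup_n \bigcup_m (F n `&` G m).
  rewrite setI_bigcupl; apply: eq_bigcupr => n _.
  by rewrite setI_bigcupr.
apply: bigcup_sigma_compact => n; exists (fun m => F n `&` G m) => // m.
by apply: compact_closedI => //; exact: compact_closed.
Qed.

(** * Finite products and manifolds *)

Section finite_product.
Variables (I : finType) (T : I -> topologicalType).

(** In a finite product the boxes form a neighborhood base. *)
Lemma nbhs_prodP (x : prod_topology T) (U : set (prod_topology T)) :
  nbhs x U <-> exists A : forall i, set (T i),
    (forall i, nbhs (x i) (A i)) /\ [set y | forall i, A i (y i)] `<=` U.
Proof.
split; last first.
  move=> [A [nA AU]]; apply: filterS AU _.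
  apply: (@filter_forall _ I (fun i (y : prod_topology T) => A i (y i)) _
    (nbhs_filter x)) => i.
  by apply: (@proj_continuous I T i x); exact: nA.
(* the sets that contain a box around x form a filter converging to x *)
pose F : set_system (prod_topology T) :=
  [set U | exists A : forall i, set (T i),
    (forall i, nbhs (x i) (A i)) /\ [set y | forall i, A i (y i)] `<=` U].
have FF : Filter F.
  split.
  - by exists (fun i => setT); split => // i; exact: filterT.
  - move=> P Q [A [nA AP]] [B [nB BQ]]; exists (fun i => A i `&` B i); split.
      by move=> i; exact: filterI.
    move=> y ABy; split; [apply: AP|apply: BQ] => i; by case: (ABy i).
  - by move=> P Q PQ [A [nA AP]]; exists A; split => //; exact: subset_trans PQ.
suff : F --> x by apply.
apply/cvg_sup => i V [_ [[W oW <-] Wx] WV].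
(* the box W on the i-th factor and the whole space on the others *)
exists (fun j => [set z | forall e : j = i, W (ecast k (T k) e z)]); split.
  move=> j; have [e|ne] := pselect (j = i); last first.
    by apply: filterS filterT => z _ e; case: ne.
  subst j; apply: filterS (open_nbhs_nbhs (conj oW Wx)) => z Wz e.
  by rewrite (Prop_irrelevance e erefl).
by move=> y /(_ i erefl) Wy; apply: WV.
Qed.

Lemma prod_base_seq :
  (forall i, exists b : nat -> set (T i), base_seq b) ->
  exists b : nat -> set (prod_topology T), base_seq b.
Proof.
move=> bT; pose b i := projT1 (cid (bT i)).
have bP i : base_seq (b i) by rewrite /b; case: cid.
exists (fun k => if unpickle k is Some g then
  [set x | forall i, b i ((g : {ffun I -> nat}) i) (x i)] else set0); split.
  move=> k; case: unpickle => [g|]; last exact: open0.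
  rewrite openE => x bx; apply/nbhs_prodP; exists (fun i => b i (g i)).
  by split => // i; apply: open_nbhs_nbhs; split; [exact: (bP i).1|exact: bx].
move=> x U /nbhs_prodP[A [nA AU]].
have /boolp.choice[g gP] : forall i, exists n, b i n (x i) /\ b i n `<=` A i.
  by move=> i; have [n] := (bP i).2 _ _ (nA i); exists n.
exists (pickle [ffun i => g i]).
  by rewrite pickleK => i; rewrite ffunE; exact: (gP i).1.
rewrite pickleK => y by_; apply: AU => i; apply: (gP i).2.
by move: (by_ i); rewrite ffunE.
Qed.

Lemma prod_compact_nbhs_base :
  (forall i, compact_nbhs_base (T i)) -> compact_nbhs_base (prod_topology T).
Proof.
move=> lc x U /nbhs_prodP[A [nA AU]].
have ex i : exists K, [/\ nbhs (x i) K, compact K & K `<=` A i].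
  exact: lc.
pose K i := projT1 (cid (ex i)).
have KP i : [/\ nbhs (x i) (K i), compact (K i) & K i `<=` A i].
  by rewrite /K; case: cid.
exists [set y | forall i, K i (y i)]; split.
- by apply/nbhs_prodP; exists K; split => // i; case: (KP i).
- by apply: tychonoff => i; case: (KP i).
- by move=> y Ky; apply: AU => i; case: (KP i) => _ _; apply.
Qed.

Lemma prod_continuous (S : topologicalType) (f : S -> prod_topology T) :
  (forall i, continuous (fun s => f s i)) -> continuous f.
Proof.
move=> cf s U /nbhs_prodP[A [nA AU]]; apply: filterS AU _.
apply: (@filter_forall _ I (fun i y => A i (f y i))) => i.
by apply: cf; exact: nA.
Qed.

End finite_product.

(** Images of closed balls of a chart are compact neighborhoods. *)
Lemma manifold_compact_nbhs_base (R : realType) (M : smoothManifold R) :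
  compact_nbhs_base M.
Proof.
move=> x U xU.
have [e _ ex] := atlas_cover x.
set v := chart_map e x.
have imv : (chart_map e @` chart_dom e) v by exists x.
have nimv : nbhs v (chart_map e @` chart_dom e).
  by apply: open_nbhs_nbhs; split => //; exact: chart_im_open.
have cinv : {for v, continuous (chart_inv e)} by exact: chart_inv_cont.
have nV : nbhs v (chart_map e @` chart_dom e `&` chart_inv e @^-1` U).
  apply: filterI => //; apply: cinv.
  by rewrite chart_mapK.
have [r rV] := (iffLR (nbhs_closedballP _ _)) nV.
exists (chart_inv e @` closed_ball v r%:num); split.
- have : nbhs x (chart_map e @^-1` closed_ball v r%:num `&` chart_dom e).
    apply: filterI.
      have cmap : {for x, continuous (chart_map e)} by exact: chart_map_cont.
      have nvr : nbhs v (closed_ball v r%:num).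
        by apply: (iffRL (nbhs_closedballP _ _)); exists r.
      exact: cmap nvr.
    by apply: open_nbhs_nbhs; split => //; exact: chart_dom_open.
  apply: filterS => y [vy ey]; exists (chart_map e y) => //.
  by rewrite chart_mapK.
- apply: continuous_compact.
    apply: continuous_in_subspaceT => y /[!inE] /rV[imy _].
    exact: chart_inv_cont.
  apply: bounded_closed_compact; last exact: closed_ball_closed.
  exists (r%:num + `|v|); split; first exact: num_real.
  move=> N /ltW rN y; rewrite closed_ballE // /closed_ball_ /= => vy.
  rewrite -(subrK v y) (le_trans (ler_normD _ _)) // distrC.
  by apply: le_trans rN; rewrite lerD2r.
- by move=> _ [y /rV[_ Uy] <-].
Qed.

(** * Borel sets of a topological space *)

Section borel_sets.
Implicit Types S T : ptopologicalType.

Lemma borel_open T (U : set T) : open U -> measurable (U : set (borel T)).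
Proof. by move=> oU; apply: sub_sigma_algebra. Qed.

Lemma borel_closed T (A : set T) : closed A -> measurable (A : set (borel T)).
Proof.
move=> cA; rewrite -[A]setCK; apply: measurableC.
by apply: borel_open; rewrite openC.
Qed.

Lemma borel_sigma_compact T (A : set T) : hausdorff_space T ->
  sigma_compact A -> measurable (A : set (borel T)).
Proof.
move=> hT [F cF ->]; apply: bigcupT_measurable => n.
by apply: borel_closed; exact: compact_closed.
Qed.

Lemma measurable_fun_borel d (S : measurableType d) T (f : S -> T) :
  (forall V, open V -> measurable (f @^-1` V)) ->
  measurable_fun setT (f : S -> borel T).
Proof.
move=> mf; apply: (@measurability _ _ S (borel T) setT f (@open T)) => //.
by move=> _ [V oV <-]; rewrite setTI; exact: mf.
Qed.

Lemma continuous_measurable_borel S T (f : S -> T) : continuous f ->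
  measurable_fun setT (f : borel S -> borel T).
Proof.
move=> /continuousP cf; apply: measurable_fun_borel => V oV.
by apply: borel_open; exact: cf.
Qed.

Lemma semicontinuous_measurable_borel (R : realType) T (f : T -> R) :
  (forall a, open [set x | a < f x]) ->
  measurable_fun setT (f : borel T -> R).
Proof.
move=> of_; apply: (measurability _ (RGenOInfty.measurableE R)).
move=> _ [_ [a ->] <-]; rewrite setTI; apply: borel_open.
by rewrite (_ : _ @^-1` _ = [set x | a < f x]) //; apply/seteqP; split => x /=;
  rewrite in_itv /= andbT.
Qed.

Lemma continuous_measurable_real (R : realType) T (f : T -> R) :
  continuous f -> measurable_fun setT (f : borel T -> R).
Proof.
move=> /continuousP cf; apply: semicontinuous_measurable_borel => a.
exact: (cf _ (@open_gt _ a)).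
Qed.

End borel_sets.

(** * Inner regularity of finite Borel measures *)

Section inner_regularity.
Variables (R : realType) (T : ptopologicalType).
Variable mu : {finite_measure set (borel T) -> \bar R}.
Hypothesis hT : hausdorff_space T.
Hypothesis oT : forall U : set T, open U -> sigma_compact U.

(** [A] contains a sigma-compact set of the same measure. *)
Definition inner_sigma_compact (A : set (borel T)) : Prop :=
  measurable A /\
  exists B, [/\ sigma_compact B, B `<=` A & mu (A `\` B) = 0%E].

Lemma sigma_compact_inner (A : set T) :
  sigma_compact A -> inner_sigma_compact A.
Proof.
move=> sA; split; first exact: borel_sigma_compact.
by exists A; split => //; rewrite setDv measure0.
Qed.

Lemma bigcup_inner (A : nat -> set (borel T)) :
  (forall n, inner_sigma_compact (A n)) -> inner_sigma_compact (\bigcup_n A n).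
Proof.
move=> iA; have mA n : measurable (A n) by case: (iA n).
split; first exact: bigcupT_measurable.
have /boolp.choice[B BP] n := (iA n).2.
exists (\bigcup_n B n); split.
- by apply: bigcup_sigma_compact => n; case: (BP n).
- by apply: subset_bigcup => n _; case: (BP n).
- have mB n : measurable (B n : set (borel T)).
    by apply: borel_sigma_compact => //; case: (BP n).
  apply/negligibleP.
    by apply: measurableD; exact: bigcupT_measurable.
  apply: (@negligibleS _ _ _ _ (\bigcup_n (A n `\` B n))).
    move=> x [[n _ Ax] nBx]; exists n => //; split => // Bx.
    by apply: nBx; exists n.
  apply: negligible_bigcup => n; apply/negligibleP; first exact: measurableD.
  by case: (BP n).
Qed.

Lemma sigma_compact_approx (B : set T) (e : R) : sigma_compact B -> 0 < e ->
  exists K, [/\ compact K, K `<=` B & (mu (B `\` K) <= e%:E)%E].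
Proof.
move=> sB e0; have mB := borel_sigma_compact hT sB.
case: sB mB => F cF -> mB.
pose K n := \bigcup_(i < n) F i.
have cK n : compact (K n).
  by rewrite /K bigcup_mkord; exact: bigsetU_compact.
have KB n : K n `<=` \bigcup_n F n by move=> x [i _ Fx]; exists i.
pose G n : set (borel T) := \bigcup_n F n `\` K n.
have mG n : measurable (G n).
  by apply: measurableD => //; apply: borel_closed; exact: compact_closed.
have G0 : \bigcap_n G n = set0.
  apply/seteqP; split => // x Gx; have [[i _ Fx] _] := Gx 0%N I.
  by have [_] := Gx i.+1 I; apply; exists i => /=.
have niG : nonincreasing_seq G.
  move=> m n mn; apply/subsetPset => x [Bx nK]; split => // -[i im Fx].
  by apply: nK; exists i => //=; exact: leq_trans mn.
have /= cvG : mu \o G @ \oo --> mu (\bigcap_n G n).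
  apply: nonincreasing_cvg_mu => //; last by rewrite G0.
  by rewrite ltey_eq fin_num_measure.
rewrite G0 measure0 in cvG.
have [n _ /(_ n (leqnn n)) /= nP] : \forall n \near \oo, (mu (G n) <= e%:E)%E.
  have /fine_cvgP[fG /cvgrPdist_le /(_ e e0)] := cvG.
  apply: filterS2 fG => n fn /=; rewrite sub0r normrN ger0_norm ?fine_ge0 //.
  by rewrite -lee_fin fineK.
by exists (K n); split.
Qed.

(** Countable intersections of sigma-compact sets need not be sigma-compact: up
    to a small error [sigma_compact_approx] replaces them by compact sets, whose
    intersection is compact. *)
Lemma bigcap_inner (A : nat -> set (borel T)) :
  (forall n, inner_sigma_compact (A n)) -> inner_sigma_compact (\bigcap_n A n).
Proof.
move=> iA; have mA n : measurable (A n) by case: (iA n).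
have mcA : measurable (\bigcap_n A n) by exact: bigcapT_measurable.
split => //.
have /boolp.choice[B BP] n := (iA n).2.
have ex (e : R) : 0 < e -> exists C, [/\ compact C, C `<=` \bigcap_n A n &
    (mu (\bigcap_n A n `\` C) <= e%:E)%E].
  move=> e0.
  have /boolp.choice[K KP] n : exists K, [/\ compact K, K `<=` B n &
      (mu (B n `\` K) <= (e / (2 ^ n.+1)%:R)%:E)%E].
    apply: sigma_compact_approx; first by case: (BP n).
    by rewrite divr_gt0 // ltr0n expn_gt0.
  have clK n : closed (K n) by apply: compact_closed => //; case: (KP n).
  have mK n : measurable (K n : set (borel T)) by exact: borel_closed.
  have mB n : measurable (B n : set (borel T)).
    by apply: borel_sigma_compact => //; case: (BP n).
  exists (\bigcap_n K n); split.
  - apply: (@subclosed_compact _ _ (K 0%N)); last by move=> x; exact.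
      by apply: closed_bigI => n _.
    by case: (KP 0%N).
  - move=> x Kx n _; have [_ BA _] := BP n; have [_ KB _] := KP n.
    by apply: BA; apply: KB; exact: Kx.
  - apply: le_trans (epsilon_trick0 xpredT (ltW e0)).
    apply: (@le_trans _ _ (\sum_(n <oo) mu (A n `\` K n))%E).
      apply: measure_sigma_subadditive => //.
      - by move=> n; exact: measurableD.
      - by apply: measurableD => //; exact: bigcapT_measurable.
      - move=> x [Ax nKx]; apply: contrapT => nD; apply: nKx => n _.
        apply: contrapT => nK; apply: nD; exists n => //; split => //.
        exact: Ax.
    apply: lee_nneseries => // n _.
    have [_ _ AB0] := BP n; have [_ _ BK] := KP n.
    apply: le_trans BK; rewrite -[leRHS]add0e -AB0.
    apply: le_trans (measureU2 _ _ _); [|exact: measurableD..].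
    apply: le_measure; rewrite ?inE.
    + exact: measurableD.
    + by apply: measurableU; exact: measurableD.
    + move=> x [Ax nKx]; have [Bx|nBx] := pselect (B n x); first by right.
      by left.
have /boolp.choice[C CP] m : exists C, [/\ compact C, C `<=` \bigcap_n A n &
    (mu (\bigcap_n A n `\` C) <= (m.+1%:R^-1)%:E)%E].
  by apply: ex; rewrite invr_gt0 ltr0n.
exists (\bigcup_m C m); split.
- by exists C => // m; case: (CP m).
- by apply: bigcup_sub => m _; case: (CP m).
- have mC m : measurable (C m : set (borel T)).
    by apply: borel_closed; apply: compact_closed => //; case: (CP m).
  have mD : measurable (\bigcap_n A n `\` \bigcup_m C m).
    by apply: measurableD => //; exact: bigcupT_measurable.
  apply/eqP; rewrite eq_le measure_ge0 andbT.
  apply/lee_addgt0Pr => e e0; rewrite add0e.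
  have [m me] : exists m, m.+1%:R^-1 <= e.
    exists (Num.trunc e^-1).
    rewrite invf_ple ?posrE ?ltr0n// ltW //.
    by rewrite truncnS_gt.
  apply: (@le_trans _ _ (m.+1%:R^-1)%:E); last by rewrite lee_fin.
  have [_ _] := CP m; apply: le_trans; apply: le_measure; rewrite ?inE //.
    exact: measurableD.
  by apply: setDS => x Cx; exists m.
Qed.

(** The sets that satisfy [inner_sigma_compact] together with their complement
    form a sigma-algebra containing the open sets. *)
Lemma measurable_inner (A : set (borel T)) : measurable A ->
  inner_sigma_compact A.
Proof.
pose Q (A : set (borel T)) :=
  inner_sigma_compact A /\ inner_sigma_compact (~` A).
suff : measurable `<=` Q by move=> AQ /AQ[].
apply: smallest_sub.
  split.
  - split; last by rewrite setC0; apply: sigma_compact_inner; apply: oT; exact: openT.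
    by apply: sigma_compact_inner; apply: oT; exact: open0.
  - by move=> B [QB QCB]; split; rewrite setTD // setCK.
  - move=> F QF; split; first by apply: bigcup_inner => n; case: (QF n).
    by rewrite setC_bigcup; apply: bigcap_inner => n; case: (QF n).
move=> U oU; split; first by apply: sigma_compact_inner; exact: oT.
apply: sigma_compact_inner.
have [F cF FT] := oT (@openT T).
exists (fun n => ~` U `&` F n); last by rewrite -setI_bigcupr -FT setIT.
move=> n; rewrite setIC; apply: compact_closedI => //.
by rewrite closedC.
Qed.

End inner_regularity.

(** * Measurable sections of a sigma-compact set with finite fibres *)

Section measurable_sections.
Variables T B : ptopologicalType.
Hypotheses (hT : hausdorff_space T) (hB : hausdorff_space B).
Hypothesis oT : forall U : set T, open U -> sigma_compact U.
Variables (w : nat -> set T) (wP : base_seq w).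
Variables (p : T -> B) (s0 : B -> T).
Hypotheses (cp : continuous p) (cs0 : continuous s0) (s0K : cancel s0 p).
Variable K : set T.
Hypothesis sK : sigma_compact K.
Hypothesis finK : forall x, finite_set (K `&` p @^-1` [set x]).

(* the points over which K meets w j exactly once *)
Let E (j : nat) : set B := [set x | exists t,
  [/\ K t, w j t, p t = x & forall u, K u -> w j u -> p u = x -> u = t]].

Let measurable_proj (U : set T) : open U ->
  measurable (p @` (K `&` U) : set (borel B)).
Proof.
move=> oU; apply: borel_sigma_compact => //; apply: sigma_compact_image => //.
by apply: sigma_compactI => //; exact: oT.
Qed.

Lemma base_seq_separate (t u : T) : t != u -> exists a b,
  [/\ w a t, w b u & w a `&` w b = set0].
Proof.
move: hT; rewrite open_hausdorff => h /h [[U V] /= [+ +] [oU oV /eqP UV0]].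
rewrite !inE => Ut Vu.
have [a at_ aU] := wP.2 _ _ (open_nbhs_nbhs (conj oU Ut)).
have [b bu bV] := wP.2 _ _ (open_nbhs_nbhs (conj oV Vu)).
by exists a, b; split => //; exact: subsetI_eq0 UV0.
Qed.

(* the removed part consists of the points over which K meets w j twice: two
   distinct points are separated by disjoint members of the base *)
Let EE j : E j = p @` (K `&` w j) `\` \bigcup_a \bigcup_b
  (if `[< w a `&` w b = set0 >] then
    p @` (K `&` (w a `&` w j)) `&` p @` (K `&` (w b `&` w j)) else set0).
Proof.
apply/seteqP; split => [x [t [Kt wt ptx tP]]|x].
  split; first by exists t.
  move=> [a _ [b _]]; case: asboolP => // ab0 -[].
  move=> [u [Ku [au ju] pu]] [v [Kv [bv jv] pv]].
  have : (w a `&` w b) t by split; [rewrite -(tP u)|rewrite -(tP v)].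
  by rewrite ab0.
move=> [[t [Kt wt] ptx] nx]; exists t; split => // u Ku wu pux.
have [//|ut] := eqVneq u t; exfalso.
have [a [b [au bt ab0]]] := base_seq_separate ut.
apply: nx; exists a => //; exists b => //.
rewrite ifT; last exact/asboolP.
by split; [exists u|exists t].
Qed.

Let mE j : measurable (E j : set (borel B)).
Proof.
rewrite EE; apply: measurableD; first by apply: measurable_proj; exact: wP.1.
apply: bigcupT_measurable => a; apply: bigcupT_measurable => b.
case: ifP => // _; apply: measurableI; apply: measurable_proj;
  by apply: openI; exact: wP.1.
Qed.

(* outside of E j the continuous section s0 is used *)
Let s (j : nat) (x : B) : T :=
  if pselect (E j x) is left e then projT1 (cid e) else s0 x.

Let sE j x : E j x ->
  [/\ K (s j x), w j (s j x), p (s j x) = x &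
      forall u, K u -> w j u -> p u = x -> u = s j x].
Proof. by rewrite /s; case: pselect => // e _; case: cid. Qed.

Let sN j x : ~ E j x -> s j x = s0 x.
Proof. by rewrite /s; case: pselect. Qed.

Let ms j : measurable_fun setT (s j : borel B -> borel T).
Proof.
apply: measurable_fun_borel => V oV.
have -> : s j @^-1` V = (E j `&` p @` (K `&` (w j `&` V))) `|`
    (~` E j `&` s0 @^-1` V).
  apply/seteqP; split => x /=.
    move=> Vs; have [Ex|nEx] := pselect (E j x); [left|right; split => //].
      by have [? ? ? _] := sE Ex; split => //; exists (s j x).
    by rewrite -(sN nEx).
  move=> [[Ex [t [Kt [jt Vt]] ptx]]|[nEx]]; last by rewrite (sN nEx).
  by have [_ _ _ /(_ t Kt jt ptx) <-] := sE Ex.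
apply: measurableU; apply: measurableI => //.
- by apply: measurable_proj; apply: openI => //; exact: wP.1.
- exact: measurableC.
- by apply: borel_open; move/continuousP : cs0; apply.
Qed.

Let graph (j : nat) : set (borel T) := K `&` w j `&` p @^-1` (E j).

Let mgraph j : measurable (graph j).
Proof.
apply: measurableI; first apply: measurableI.
- exact: borel_sigma_compact.
- by apply: borel_open; exact: wP.1.
- rewrite -[X in measurable X]setTI.
  exact: (continuous_measurable_borel cp).
Qed.

Let graphK : \bigcup_j graph j = K.
Proof.
apply/seteqP; split => [t [j _ [[]]]//|t Kt].
(* the other points of the fibre of t form a closed set, being finite *)
pose F := (K `&` p @^-1` [set p t]) `\ t.
have clF : closed F.
  apply: (iffLR accessible_finite_set_closed (hausdorff_accessible hT)).
  exact: finite_setD.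
have nF : nbhs t (~` F).
  by apply: open_nbhs_nbhs; split; [rewrite openC|move=> [_ /(_ erefl)]].
have [j jt jF] := wP.2 _ _ nF.
exists j => //; split => //; exists t; split => // u Ku ju pu.
by apply: contrapT => ut; apply: (jF _ ju).
Qed.

(** [K] is a disjoint union of Borel sets, each contained in the image of a
    Borel section of [p]. *)
Theorem measurable_sections_cover :
  exists (sec : nat -> B -> T) (D : nat -> set (borel T)),
  [/\ forall j, measurable_fun setT (sec j : borel B -> borel T),
      forall j, cancel (sec j) p,
      forall j, measurable (D j),
      trivIset setT D &
      \bigcup_j D j = K /\ forall j t, D j t -> sec j (p t) = t].
Proof.
exists s, (seqDU graph); split; [exact: ms | | | exact: trivIset_seqDU |].
- move=> j x; have [Ex|nEx] := pselect (E j x); first by have [_ _ ->] := sE Ex.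
  by rewrite sN.
- by move=> j; exact: seqDU_measurable.
- split; first by rewrite -seqDU_bigcup_eq.
  move=> j t Dt; have [[Kt jt] Et] := subset_seqDU Dt.
  by have [_ _ _ /(_ t Kt jt erefl) <-] := sE Et.
Qed.

End measurable_sections.

(** * Densities of a measure carried by countably many graphs *)

Lemma integral_mrestr d (T : measurableType d) (R : realType)
    (m : {measure set T -> \bar R}) (D : set T) (mD : measurable D)
    (f : T -> \bar R) : measurable_fun setT f ->
  (\int[mrestr m mD]_x f x = \int[m]_(x in D) f x)%E.
Proof.
move=> mf.
transitivity (\int[mrestr m mD]_(x in D) f x)%E; last first.
  by apply: eq_measure_integral => A mA AD; rewrite /= /mrestr setIidl.
rewrite [RHS]integral_mkcond; apply: ae_eq_integral => //.
  by apply/(measurable_restrictT f mD); exact: measurable_funTS.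
exists (~` D); split; [exact: measurableC|by rewrite /= /mrestr setICl measure0|].
by move=> x /= nx Dx; apply: nx => _; rewrite patchE mem_set.
Qed.

Section densities.
Context d d' (T : measurableType d) (B : measurableType d') (R : realType).
Variables (P : probability T R) (mu : probability B R) (p : T -> B).
Hypothesis mp : measurable_fun setT p.
Hypothesis marg : forall A, measurable A -> P (p @^-1` A) = mu A.
Variables (sec : nat -> B -> T) (D : nat -> set T).
Hypothesis msec : forall j, measurable_fun setT (sec j).
Hypothesis mD : forall j, measurable (D j).
Hypothesis tD : trivIset setT D.
Hypothesis DP : P (~` \bigcup_j D j) = 0%E.
Hypothesis secK : forall j t, D j t -> sec j (p t) = t.

(* the projection of the part of P carried by D j *)
Let nu j := pushforward (mrestr P (mD j)) p.

Let nu_measure j : {measure set B -> \bar R} :=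
  measure_function_pushforward__canonical__measure_function_Measure
    (mrestr P (mD j)) mp.
Let fin_nu j : fin_num_fun (nu j).
Proof.
move=> A mA; apply: (fin_num_measure (mrestr P (mD j))).
by rewrite -[X in measurable X]setTI; exact: mp.
Qed.
HB.instance Definition _ j := Measure.copy (nu j) (nu_measure j).
HB.instance Definition _ j := @Measure_isFinite.Build _ B R (nu j) (fin_nu j).

Let dominated j : nu j `<< mu.
Proof.
apply/null_content_dominatesP => A mA muA0.
have mpA : measurable (p @^-1` A) by rewrite -[X in measurable X]setTI; exact: mp.
apply/eqP; rewrite eq_le measure_ge0 andbT.
apply: (@le_trans _ _ (P (p @^-1` A))); last by rewrite marg // muA0.
by apply: le_measure; rewrite ?inE //; exact: measurableI.
Qed.

Let rn j := Radon_Nikodym_SigmaFinite.f (nu j) mu.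

Let density j x := fine (rn j x).

Let densityE j x : (density j x)%:E = rn j x.
Proof.
by rewrite fineK //; apply: Radon_Nikodym_SigmaFinite.f_fin_num; exact: dominated.
Qed.

Let mrn j : measurable_fun setT (rn j).
Proof.
apply: (@measurable_int _ _ _ mu).
exact: (Radon_Nikodym_SigmaFinite.f_integrable (@dominated j)).
Qed.

Let mdensity j : measurable_fun setT (density j).
Proof. by apply: measurableT_comp => //; exact: mrn. Qed.

Let density_ge0 j x : 0 <= density j x.
Proof.
by apply: fine_ge0; apply: Radon_Nikodym_SigmaFinite.f_ge0; exact: dominated.
Qed.

Let int_density j (f : T -> R) (M : R) : measurable_fun setT f ->
  (forall t, `|f t| <= M) ->
  (\int[mu]_x (density j x * f (sec j x))%:E = \int[P]_(t in D j) (f t)%:E)%E.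
Proof.
move=> mf fM.
have mfs : measurable_fun setT (f \o sec j) by exact: measurableT_comp.
have int_fs (m : {finite_measure set B -> \bar R}) :
    m.-integrable setT (EFin \o (f \o sec j)).
  apply: measurable_bounded_integrable => //.
    by rewrite ltey_eq fin_num_measure.
  exists M; split; first exact: num_real.
  by move=> N /ltW MN x _ /=; exact: le_trans MN.
have int_f (m : {finite_measure set T -> \bar R}) :
    m.-integrable setT (EFin \o (f \o sec j \o p)).
  apply: measurable_bounded_integrable => //.
  - by rewrite ltey_eq fin_num_measure.
  - exact: measurableT_comp.
  exists M; split; first exact: num_real.
  by move=> N /ltW MN x _ /=; exact: le_trans MN.
transitivity (\int[nu j]_x (f (sec j x))%:E)%E.
  rewrite -(@Radon_Nikodym_change_of_variables _ _ _ (nu j) mu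
    (@dominated j) (EFin \o (f \o sec j))) //.
  under eq_integral do rewrite EFinM densityE muleC.
  apply: ae_eq_integral => //.
  - by apply: emeasurable_funM => //; exact/measurable_EFinP.
  - apply: emeasurable_funM; first exact/measurable_EFinP.
    apply: (@measurable_int _ _ _ mu).
    by apply: Radon_Nikodym_integrable; exact: dominated.
  - apply: ae_eqe_mul2l.
    by apply: ae_eq_Radon_Nikodym_SigmaFinite => //; exact: dominated.
transitivity (\int[P]_(t in D j) (f (sec j (p t)))%:E)%E.
  rewrite -(integral_mrestr P (mD j)); last exact: (measurable_int _ (int_f P)).
  rewrite /nu (integral_pushforward mp) //; first exact/measurable_EFinP.
  exact: (int_f (mrestr P (mD j))).
by apply: eq_integral => t /[!inE] Dt; rewrite secK.
Qed.

Let cvg_integral_bigcup (f : T -> R) (M : R) : measurable_fun setT f ->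
  (forall t, `|f t| <= M) ->
  (fun N => \sum_(j < N) \int[P]_(t in D j) (f t)%:E)%E @ \oo -->
  (\int[P]_t (f t)%:E)%E.
Proof.
move=> mf fM.
pose U N := \big[setU/set0]_(j < N) D j.
have mU N : measurable (U N) by exact: bigsetU_measurable.
have -> : (fun N => \sum_(j < N) \int[P]_(t in D j) (f t)%:E)%E =
    (fun N => \int[P]_t ((EFin \o f) \_ (U N)) t)%E.
  apply/funext => N; rewrite -integral_mkcond /U -(big_mkord xpredT).
  rewrite integral_bigsetU_EFin ?iota_uniq ?big_mkord //.
    exact: sub_trivIset tD.
  by apply: measurable_funTS; exact/measurable_EFinP.
have mfE : measurable_fun setT (EFin \o f) by exact/measurable_EFinP.
have [|||||_ _] := @dominated_convergence _ _ _ P setT measurableT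
  (fun N => (EFin \o f) \_ (U N)) (EFin \o f) (cst M%:E) => //.
- by move=> N; apply/(measurable_restrictT _ (mU N)); exact: measurable_funTS.
- exists (~` \bigcup_j D j); split => //.
    by apply: measurableC; exact: bigcupT_measurable.
  move=> t /= nt [j _ Dt]; apply: nt => _.
  apply: cvg_near_cst; exists j.+1 => // N /= jN.
  rewrite patchE mem_set //; rewrite /U -bigcup_mkord.
  by exists j.
- exact: finite_measure_integrable_cst.
- apply: aeW => t N _; rewrite patchE; case: ifP => _ /=.
    by rewrite lee_fin.
  by rewrite normr0 lee_fin (le_trans _ (fM t)).
Qed.

Let density_sum1 :
  {ae mu, forall x, (fun N => \sum_(j < N) (density j x)%:E)%E @ \oo --> 1%E}.
Proof.
have d0 x j : (0 <= (density j x)%:E)%E by rewrite lee_fin.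
have mE j : measurable_fun setT (EFin \o density j) by exact/measurable_EFinP.
have : ae_eq mu setT (cst 1%E) (fun x => \sum_(j <oo) (density j x)%:E)%E.
  apply: integral_ae_eq => //.
  - exact: finite_measure_integrable_cst.
  - apply: (@ge0_emeasurable_sum _ _ R setT _ xpredT) => [j x _ _|j _].
      exact: d0.
    exact: mE.
  - move=> E _ mEE; rewrite integral_cst // mul1e.
    have mEj j : measurable_fun E (EFin \o density j) by exact: measurable_funTS.
    rewrite (integral_nneseries mu mEE mEj); last by move=> j x _; exact: d0.
    have mpE : measurable (p @^-1` E) by rewrite -[X in measurable X]setTI; exact: mp.
    transitivity (\sum_(j <oo) P (p @^-1` E `&` D j))%E; last first.
      apply: eq_eseriesr => j _; under eq_integral do rewrite /= densityE.
      by rewrite -Radon_Nikodym_SigmaFinite.f_integral //; exact: dominated.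
    rewrite -measure_semi_bigcup //; first last.
    - by apply: bigcupT_measurable => j; exact: measurableI.
    - exact: trivIset_setIl.
    - by move=> j; exact: measurableI.
    rewrite -setI_bigcupr; transitivity (P (p @^-1` E)); first by rewrite marg.
    have mC : measurable (\bigcup_j D j) by exact: bigcupT_measurable.
    rewrite (measureDI P mpE mC) setDE.
    rewrite (@subset_measure0 _ _ _ P _ (~` \bigcup_j D j)) ?add0e //.
      by apply: measurableI => //; exact: measurableC.
    exact: measurableC.
apply: filterS => x /(_ I) /= s1.
rewrite [X in _ --> X]s1.
have := @is_cvg_nneseries R (fun j => (density j x)%:E) xpredT 0 (fun j _ _ => d0 x j).
by under eq_fun do rewrite big_mkord.
Qed.

(** If [P] is carried by the disjoint sets [D j], where [D j] is part of the
    image of the section [sec j], and [mu] is the image of [P] under [p], then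
    [P] is the sum of the images under [sec j] of measures with densities with
    respect to [mu].  Only bounded measurable test functions are considered. *)
Theorem graph_densities : exists alpha : nat -> B -> R,
  [/\ forall j, measurable_fun setT (alpha j) /\ (forall x, 0 <= alpha j x),
      forall (f : T -> R) (M : R), measurable_fun setT f ->
        (forall t, `|f t| <= M) ->
        (fun N => \sum_(j < N)
           \int[mu]_x (alpha j x * f (sec j x))%:E)%E @ \oo -->
        (\int[P]_t (f t)%:E)%E &
      {ae mu, forall x, (fun N => \sum_(j < N) (alpha j x)%:E)%E @ \oo --> 1%E}].
Proof.
exists density; split => //.
move=> f M mf fM; rewrite (_ : (fun N : nat => _) =
    (fun N => \sum_(j < N) \int[P]_(t in D j) (f t)%:E)%E).
  exact: cvg_integral_bigcup.
by apply/funext => N; apply: eq_bigr => j _; exact: int_density.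
Qed.

End densities.

(** In a second countable space a probability measure is carried by its
    support, whose complement is a countable union of null basic open sets. *)
Lemma msupport_full (R : realType) (T : ptopologicalType) (w : nat -> set T)
    (P : probability (borel T) R) : base_seq w ->
  measurable (msupport P : set (borel T)) /\ P (~` msupport P) = 0%E.
Proof.
move=> [wo wn].
have E : ~` msupport P = \bigcup_(n in [set n | P (w n) = 0%E]) w n.
  apply/seteqP; split => [x nx|x [n Pn wx] sx]; last first.
    by have := sx (w n) (wo n) wx; rewrite Pn ltxx.
  apply: contrapT => nw; apply: nx => U oU Ux.
  have [n wx wU] := wn x U (open_nbhs_nbhs (conj oU Ux)).
  apply: (@lt_le_trans _ _ (P (w n))).
    rewrite lt_neqAle measure_ge0 andbT; apply/eqP => Pn.
    by apply: nw; exists n => //=; rewrite -Pn.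
  by apply: le_measure; rewrite ?inE //; exact: borel_open.
have oC : open (~` msupport P) by rewrite E; apply: bigcup_open.
split; first by rewrite -[msupport P]setCK; apply: measurableC; exact: borel_open.
have : P.-negligible (\bigcup_n (if `[< P (w n) = 0%E >] then w n else set0)).
  apply: negligible_bigcup => n; case: asboolP => [Pn|_]; last exact: negligible_set0.
  by apply/negligibleP => //; exact: borel_open.
move=> N; apply/negligibleP; first exact: borel_open.
apply: negligibleS N; rewrite E => x [n /= Pn wx]; exists n => //.
by rewrite ifT //; apply/asboolP.
Qed.

(** * First-order condition at a contact point *)

Lemma derive_ge0_at_min (R : realType) (V : normedModType R) (f : V -> R^o)
    (a v : V) : derivable f a v -> (forall y, f a <= f y) -> 0 <= 'D_v f a.
Proof.
move=> df fmin.
rewrite ['D_v f a]cvg_at_rightE; last exact: df.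
apply: limr_ge.
  rewrite -(cvg_at_rightE (fun h : R => h^-1 *: ((f \o shift a) (h *: v) - f a))) //.
  apply: cvg_trans df; apply: cvg_app.
  move=> A [e egt0 Ae]; exists e => // x xe xgt0; apply: Ae => //.
  exact/lt0r_neq0.
near=> h; apply: mulr_ge0.
  by rewrite invr_ge0; apply: ltW; near: h; exists 1 => /=.
by rewrite subr_ge0 /=; exact: fmin.
Unshelve. all: by end_near. Qed.

(** At a minimum of [f - g] the differentials agree; differentiability is needed
    at that point only. *)
Lemma diff_eq_at_contact (R : realType) (V : normedModType R) (f g : V -> R^o)
    (a : V) (k : R) : differentiable f a -> differentiable g a ->
  (forall y, g y + k <= f y) -> g a + k = f a ->
  'd f a = 'd g a :> (V -> R^o).
Proof.
move=> df dg gf gfa.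
have dh : differentiable (f - g : V -> R^o) a by exact: differentiableB.
have ge0 v : 0 <= 'd (f - g : V -> R^o) a v.
  rewrite -deriveE //; apply: derive_ge0_at_min; first exact: diff_derivable.
  move=> y; rewrite !fctE /= -gfa [leLHS]addrAC subrr add0r.
  by rewrite lerBrDr addrC.
apply/funext => v; apply/eqP; rewrite -subr_eq0.
have -> : 'd f a v - 'd g a v = 'd (f - g : V -> R^o) a v.
  exact: (esym (congr1 (fun d : V -> R^o => d v) (diffB df dg))).
rewrite eq_le ge0 andbT -oppr_ge0 -linearN; exact: ge0.
Qed.

(** The inverse of a chart is a total function, so the comparison of [f] and [g]
    on the whole of [M] is read in coordinates without localizing. *)
Lemma mderiv_eq_at_contact (R : realType) (M : smoothManifold R) (f g : M -> R)
    (x : M) (k : R) : mdifferentiable f x -> mdifferentiable g x ->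
  (forall y, g y + k <= f y) -> g x + k = f x -> mderiv f x = mderiv g x.
Proof.
move=> df dg gf gfx; apply/funext => e; apply/funext => v; rewrite /mderiv.
case: asboolP => [ex|_]; last by [].
have gfe y : (g \o chart_inv e) y + k <= (f \o chart_inv e) y by exact: gf.
have gfxe : (g \o chart_inv e) (chart_map e x) + k =
    (f \o chart_inv e) (chart_map e x).
  by case: ex => _ ex; rewrite /= chart_mapK.
exact: (congr1 (fun d => d v) (diff_eq_at_contact (df e ex) (dg e ex) gfe gfxe)).
Qed.

(** * The contact set of a dual solution *)

(** Change of variables along a marginal map [p]. *)
Lemma integrable_marginal d d' (T : measurableType d) (B : measurableType d')
    (R : realType) (P : {measure set T -> \bar R}) (mu : {measure set B -> \bar R})
    (p : T -> B) (f : B -> R) : measurable_fun setT p ->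
  (forall A, measurable A -> pushforward P p A = mu A) ->
  mu.-integrable setT (EFin \o f) ->
  P.-integrable setT (fun t => (f (p t))%:E) /\
  (\int[P]_t (f (p t))%:E = \int[mu]_x (f x)%:E)%E.
Proof.
move=> mp marg mu_f.
have mf : measurable_fun setT (EFin \o f) by exact: measurable_int mu_f.
have Pf : P.-integrable setT (fun t => (f (p t))%:E).
  apply/integrableP; split; first exact: (measurableT_comp mf mp).
  have /integrableP[_] := mu_f; apply: le_lt_trans.
  have mfa : measurable_fun setT (abse \o (EFin \o f)) by exact: measurableT_comp.
  have := @ge0_integral_pushforward _ _ _ _ R p mp P setT _ measurableT mfa.
  rewrite preimage_setT => /= <- //; rewrite le_eqVlt; apply/orP; left; apply/eqP.
  by apply: eq_measure_integral => A mA _; exact: marg.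
split => //.
have := @integral_pushforward _ _ _ _ R p mp P setT _ mf.
rewrite preimage_setT => /(_ Pf measurableT) /= <-.
by apply: eq_measure_integral => A mA _; exact: marg.
Qed.

Section cost.
Variables (R : realType) (n : nat) (X : 'I_n.+2 -> smoothManifold R).

Lemma measurable_coord i :
  measurable_fun setT (fun x : borel (mprod X) => x i : borel (X i)).
Proof. by apply: continuous_measurable_borel; exact: (@proj_continuous _ _ i). Qed.

Variable mu : forall i, probability (borel (X i)) R.
Variable c : mprod X -> R.
Hypothesis hc : standing_assumptions mu c.
Variable gamma : probability (borel (mprod X)) R.
Hypothesis hgamma : optimal_plan mu c gamma.

Lemma measurable_cost : measurable_fun setT (c : borel (mprod X) -> R).
Proof.
apply: semicontinuous_measurable_borel => a.
have /lower_semicontinuousP/(_ a) := cost_lsc hc.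
by congr open; apply/seteqP; split => x /=; rewrite lte_fin.
Qed.

Lemma integrable_cost : gamma.-integrable setT (EFin \o c).
Proof.
apply/integrableP; split; first by apply/measurable_EFinP; exact: measurable_cost.
have [pi pi_plan pi_fin] := cost_finite hc.
under eq_integral => x _ do rewrite /= ger0_norm ?(cost_ge0 hc) //.
apply: le_lt_trans (hgamma.2 _ pi_plan) _.
by rewrite ltey_eq pi_fin.
Qed.

Variable phi : forall i, X i -> R.
Arguments phi : clear implicits.
Hypothesis mphi : forall i, measurable_fun setT (phi i : borel (X i) -> R).
Hypothesis iphi : forall i, (mu i).-integrable setT (EFin \o phi i).
Hypothesis phi_le : forall x : mprod X, \sum_i phi i (x i) <= c x.
Hypothesis phi_dual :
  (\int[gamma]_x (c x)%:E = \sum_i \int[mu i]_x (phi i x)%:E)%E.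

(* the contact set *)
Let S : set (borel (mprod X)) := [set x | \sum_i phi i (x i) = c x].

Let msum : measurable_fun setT
  (fun x : borel (mprod X) => \sum_i phi i (x i)).
Proof.
apply: (@measurable_sum _ (borel (mprod X)) R setT _ _
  (fun i (x : borel (mprod X)) => phi i (x i))) => i.
exact: (measurableT_comp (@mphi i) (@measurable_coord i)).
Qed.

(** Complementary slackness: [c - \sum_i phi i] is non-negative and has integral
    zero. *)
Lemma contact_full : measurable S /\ gamma (~` S) = 0%E.
Proof.
pose g (x : borel (mprod X)) := c x - \sum_i phi i (x i).
have mg : measurable_fun setT g.
  by apply: measurable_funB => //; exact: measurable_cost.
have SE : S = g @^-1` [set 0].
  by apply/seteqP; split => x /=; rewrite /S /g /= => /eqP;
    [rewrite eq_sym -subr_eq0 => /eqP|rewrite subr_eq0 eq_sym => /eqP].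
have mS : measurable S.
  by rewrite SE -[X in measurable X]setTI; apply: mg.
split => //.
have marg0 i A (mA : measurable A) := hgamma.1 i A mA.
have marg i := @integrable_marginal _ _ _ _ R gamma (mu i) _ (phi i)
  (@measurable_coord i) (@marg0 i) (@iphi i).
have isum : gamma.-integrable setT
    (fun x => \sum_i (phi i (x i))%:E)%E.
  by apply: integrable_sum => // i _; case: (marg i).
have g0 : (\int[gamma]_x (g x)%:E = 0)%E.
  transitivity (\int[gamma]_x ((EFin \o c) x - \sum_i (phi i (x i))%:E))%E.
    by apply: eq_integral => x _; rewrite /= sumEFin.
  rewrite integralB //; last exact: integrable_cost.
  rewrite integral_sum //; last by move=> i; case: (marg i).
  under [X in (_ - X)%E]eq_bigr do rewrite (marg _).2.
  rewrite /= -phi_dual subee // integrable_fin_num //.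
  exact: integrable_cost.
have mgE : measurable_fun setT (EFin \o g) by exact/measurable_EFinP.
have gabs : (\int[gamma]_x `|(EFin \o g) x| = 0)%E.
  by rewrite -g0; apply: eq_integral => x _; rewrite /= ger0_norm // subr_ge0.
have [N [mN N0 sN]] := iffLR (ae_eq_integral_abs gamma measurableT mgE) gabs.
apply/negligibleP; first exact: measurableC.
exists N; split => // x nSx; apply: sN => /= h; apply: nSx.
by rewrite SE /=; case: (h I).
Qed.

(** In the first variable [c] dominates [phi ord0] up to a constant, with
    equality at [x ord0]. *)
Lemma Dx1_contact x : S x -> D1 c x -> mdifferentiable (phi ord0) (x ord0) ->
  Dx1 c x = mderiv (phi ord0) (x ord0).
Proof.
move=> Sx Dx dphi.
apply: (@mderiv_eq_at_contact _ _ _ _ _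
  (\sum_(j < n.+1) phi (lift ord0 j) (x (lift ord0 j)))) => //.
- move=> y; apply: le_trans (phi_le (dfwith x ord0 y)).
  rewrite [leRHS]big_ord_recl dfwithin lerD2l; apply: ler_sum => j _.
  by rewrite dfwithout.
- rewrite /first_slice -(big_ord_recl (n.+1) (fun i => phi i (x i))) Sx.
  congr c; apply: functional_extensionality_dep => i.
  by case: dfwithP.
Qed.

End cost.

(** * Decomposition of optimal plans *)

Section manifold_product.
Variables (R : realType) (n : nat).

Lemma mprod_hausdorff (X : 'I_n -> smoothManifold R) :
  hausdorff_space (mprod X).
Proof. by apply: hausdorff_product => i; exact: manifold_hausdorff. Qed.

Lemma mprod_base_seq (X : 'I_n -> smoothManifold R) :
  exists w : nat -> set (mprod X), base_seq w.
Proof.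
apply: prod_base_seq => i; apply: second_countable_base_seq.
exact: manifold_second_countable.
Qed.

Lemma mprod_open_sigma_compact (X : 'I_n -> smoothManifold R)
    (U : set (mprod X)) : open U -> sigma_compact U.
Proof.
have [w wP] := mprod_base_seq X.
apply: (open_sigma_compact wP); apply: prod_compact_nbhs_base => i.
exact: manifold_compact_nbhs_base.
Qed.

Variable X : 'I_n.+1 -> smoothManifold R.

(** The projection onto X_2 x ... x X_n. *)
Definition tail_of (t : mprod X) : mtail X := fun j => t (lift ord0 j).

Lemma tail_of_continuous : continuous tail_of.
Proof. by apply: prod_continuous => j; exact: (@proj_continuous _ _ (lift ord0 j)). Qed.

Lemma mcons_tail_of (t : mprod X) : mcons (t ord0) (tail_of t) = t :> mprod X.
Proof.
apply: functional_extensionality_dep => i.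
by case: (unliftP ord0 i) => [j|] ->; rewrite ?mcons_lift ?mcons0.
Qed.

Lemma mcons_continuous (y : mtail X) :
  continuous (fun x : X ord0 => mcons x y : mprod X).
Proof.
apply: prod_continuous => i; case: (unliftP ord0 i) => [j|] ->.
  rewrite (_ : (fun s => _) = cst (y j)); first exact: cst_continuous.
  by apply/funext => s; rewrite mcons_lift.
rewrite (_ : (fun s => _) = id); first by move=> s; exact: cvg_id.
by apply/funext => s; rewrite mcons0.
Qed.

End manifold_product.

Theorem proposition1p2 (R : realType) (n : nat)
    (X : 'I_n.+2 -> smoothManifold R)
    (mu : forall i, probability (borel (X i)) R)
    (c : mprod X -> R)
    (hc : standing_assumptions mu c)
    (htwist : generalized_twist c)
    (hmu : non_atomic (mu ord0))
    (gamma : probability (borel (mprod X)) R)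
    (hgamma : optimal_plan mu c gamma)
    (hsupp : msupport gamma `<=` D1 c) :
  exists (k : option nat) (alpha : nat -> X ord0 -> R)
         (G : nat -> X ord0 -> mtail X),
  [/\ forall i, index_lt k i ->
        measurable_fun setT (alpha i : borel (X ord0) -> R) /\
        (forall x, 0 <= alpha i x),
      forall i, index_lt k i ->
        measurable_fun setT (G i : borel (X ord0) -> borel (mtail X)),
      is_sum_of_graphs gamma (mu ord0) k alpha G &
      {ae mu ord0, forall x, has_sum k (fun i => (alpha i x)%:E) 1%E}].
Proof.
have [phi [mphi iphi [N [mN N0 dphi]] phi_le phi_dual]] := cost_dual hc.
have [w wP] := mprod_base_seq X.
pose p (t : mprod X) : X ord0 := t ord0.
have cp : continuous p := @proj_continuous _ _ ord0.
have mp : measurable_fun setT (p : borel (mprod X) -> borel (X ord0)).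
  exact: continuous_measurable_borel.
have marg (A : set (borel (X ord0))) : measurable A -> gamma (p @^-1` A) = mu ord0 A.
  exact: hgamma.1.
pose S : set (borel (mprod X)) := [set x | \sum_i phi i (x i) = c x].
have [mS S0] : measurable S /\ gamma (~` S) = 0%E.
  by apply: (contact_full hc hgamma) => //; exact: phi_dual.
have [mM M0] := msupport_full gamma wP.
have mpN : measurable (p @^-1` (~` N) : set (borel (mprod X))).
  by rewrite -[X in measurable X]setTI; apply: mp => //; exact: measurableC.
(* gamma is carried by Gam, whose fibres over X_1 are finite *)
pose Gam : set (borel (mprod X)) := S `&` msupport gamma `&` p @^-1` (~` N).
have mGam : measurable Gam by do 2 apply: measurableI => //.
have Gam0 : gamma (~` Gam) = 0%E.
  apply/negligibleP; first exact: measurableC.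
  rewrite /Gam !setCI; apply: negligibleU; first apply: negligibleU.
  - by apply/negligibleP => //; exact: measurableC.
  - by apply/negligibleP => //; exact: measurableC.
  - rewrite -preimage_setC setCK; apply/negligibleP.
      by rewrite -[X in measurable X]setTI; exact: mp.
    by apply: etrans (marg _ mN) N0.
have hT := @mprod_hausdorff R _ X.
have oT := @mprod_open_sigma_compact R _ X.
have [_ [K [sK KGam K0]]] := measurable_inner gamma hT oT mGam.
have mK : measurable (K : set (borel (mprod X))) by exact: borel_sigma_compact.
have CK0 : gamma (~` (K : set (borel (mprod X)))) = 0%E.
  apply/negligibleP; first exact: measurableC.
  apply: (@negligibleS _ _ _ _ (~` Gam `|` (Gam `\` K))).
    move=> x nKx; have [Gx|nGx] := pselect (Gam x); [by right|by left].
  apply: negligibleU.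
    by apply/negligibleP => //; exact: measurableC.
  by apply/negligibleP => //; exact: measurableD.
(* on Gam the derivative of c only depends on the first coordinate *)
have splitS : c_splitting c S by exists phi; split.
have dGam t : Gam t -> Dx1 c t = mderiv (phi ord0) (t ord0).
  move=> [[St Mt] Nt]; apply: (@Dx1_contact _ _ _ _ _ phi_le) => //.
    exact: hsupp.
  by apply: contrapT => nd; apply: Nt; exact: dphi.
have finK x : finite_set (K `&` p @^-1` [set x]).
  have [[t0 [Kt0 pt0]]|no] := pselect (exists t, K t /\ p t = x); last first.
    rewrite (_ : _ `&` _ = set0) //; apply/seteqP; split => // t [Kt pt].
    by apply: no; exists t.
  have G0 := KGam _ Kt0; have [[St0 Mt0] _] := G0.
  have := htwist S splitS t0 (conj St0 (hsupp _ Mt0)).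
  apply: sub_finite_set => t [Kt pt].
  have Gt := KGam _ Kt; have [[St Mt] _] := Gt.
  have tt0 : t ord0 = t0 ord0 by rewrite -/(p t) pt -pt0.
  split; [exact: conj St (hsupp _ Mt) | exact: tt0 |].
  by rewrite (dGam _ G0) (dGam _ Gt) tt0.
have pmcons : cancel (fun x : X ord0 => mcons x (point : mtail X) : mprod X) p.
  by move=> x; rewrite /p mcons0.
have [sec [D [msec secp mD tD [DK secK]]]] := measurable_sections_cover hT
  (@manifold_hausdorff _ (X ord0)) oT wP cp (@mcons_continuous _ _ X point) pmcons sK finK.
have DC0 : gamma (~` \bigcup_j D j) = 0%E by rewrite DK.
have [alpha [malpha sum_alpha alpha1]] :=
  graph_densities mp marg msec mD tD DC0 secK.
exists None, alpha, (fun i x => tail_of (sec i x)); split => //.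
- move=> i _.
  exact: (measurableT_comp
    (continuous_measurable_borel (@tail_of_continuous _ _ X)) (msec i)).
- move=> f cf [M fM] /=.
  have fE i x : f (mcons x (tail_of (sec i x))) = f (sec i x).
    congr f; rewrite -[RHS]mcons_tail_of; congr (mcons _ _).
    exact: esym (secp i x).
  rewrite (_ : (fun N : nat => _) =
    (fun N => \sum_(i < N) \int[mu ord0]_x (alpha i x * f (sec i x))%:E)%E).
    exact: (sum_alpha f M (continuous_measurable_real cf) fM).
  apply/funext => m; apply: eq_bigr => i _; apply: eq_integral => x _.
  by rewrite fE.
Qed.
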